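(* Let $n$ be a positive integer and suppose $\chi=(P_1,\ldots,P_{2n})$ is a degree one vector field on $\mathbb{S}^{2n-1}$ such that $(P_1,\ldots,P_{2n})^t=Ax$, where $A=(a_{ij})_{2n\times 2n}$ is a constant real skew-symmetric matrix and $x=(x_1,\ldots,x_{2n})^t$. Then $\chi$ is a Hamiltonian vector field if and only if the matrix $B=(b_{ij})_{2n\times 2n}$ defined by $b_{2i-1,j}=a_{2i,j}$ and $b_{2i,j}=-a_{2i-1,j}$ (for $1\le i\le n$, $1\le j\le 2n$) is symmetric.
   Context: $\mathbb{S}^{2n-1}=\{x\in\mathbb{R}^{2n} : \sum_i x_i^2=1\}$. A polynomial vector field $\chi=(P_1,\ldots,P_{2n})$ in $\mathbb{R}^{2n}$ is identified with the operator $\sum_i P_i\,\partial/\partial x_i$; its degree is $\max_i\deg P_i$. It is a vector field on $\mathbb{S}^{2n-1}$ if $\chi(\sum_i x_i^2-1)=K(\sum_i x_i^2-1)$ for some real polynomial $K$. A vector field $\chi=(P_1,\ldots,P_{2n})$ is called Hamiltonian if there is a smooth map $H:\mathbb{R}^{2n}\to\mathbb{R}$ such that $P_{2i-1}=-\frac{\partial H}{\partial x_{2i}}$ and $P_{2i}=\frac{\partial H}{\partial x_{2i-1}}$ for $1\le i\le n$. *)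

(* Defs.v *)
From HB Require Import structures.
From mathcomp Require Import all_boot all_order all_algebra.
From mathcomp Require Import all_classical all_reals all_analysis.
From mathcomp Require mpoly.
(* The notations of mpoly clash with those of mathcomp-analysis. *)
Import -(notations) mpoly.

Set Implicit Arguments.
Unset Strict Implicit.
Unset Printing Implicit Defensive.

Import GRing.Theory.
Import numFieldNormedType.Exports.

Local Open Scope ring_scope.

Notation polyvf R m := 'cV[mpoly m R]_m.

Definition coords (R : realType) (m : nat) : 'cV[mpoly m R]_m :=
  \col_i mpolyX R (mnm1 i).

(* [msize p] is one more than the total degree of [p], and [msize 0 = 0]. *)
Definition vf_degree (R : realType) (m : nat) (P : polyvf R m) : nat :=
  \max_(i < m) (msize (P i 0%R)).-1.

Definition vf_apply (R : realType) (m : nat) (P : polyvf R m)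
    (f : mpoly m R) : mpoly m R :=
  \sum_(i < m) P i 0 * mderiv i f.

Definition sphere_poly (R : realType) (m : nat) : mpoly m R :=
  \sum_(i < m) coords R m i 0 ^+ 2 - 1.

Definition vf_on_sphere (R : realType) (m : nat) (P : polyvf R m) : Prop :=
  exists K : mpoly m R, vf_apply P (sphere_poly R m) = K * sphere_poly R m.

Definition partial (R : realType) (m : nat) (i : 'I_m) (f : 'cV[R]_m -> R) :
    'cV[R]_m -> R :=
  fun x => 'D_(delta_mx i 0) f x.

Fixpoint class_C (R : realType) (m k : nat) (f : 'cV[R]_m -> R) : Prop :=
  match k with
  | 0%N => continuous f
  | k'.+1 => continuous f /\
      forall i : 'I_m,
        (forall x, derivable f x (delta_mx i 0)) /\ class_C k' (partial i f)
  end.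

Definition smooth (R : realType) (m : nat) (f : 'cV[R]_m -> R) : Prop :=
  forall k, class_C k f.

Lemma idx1_subproof (n : nat) (i : 'I_n) : (2 * i < 2 * n)%N.
Proof. by rewrite ltn_pmul2l. Qed.

Lemma idx2_subproof (n : nat) (i : 'I_n) : ((2 * i).+1 < 2 * n)%N.
Proof. by rewrite !mul2n -doubleS leq_double. Qed.

Lemma half_subproof (n : nat) (k : 'I_(2 * n)) : (k./2 < n)%N.
Proof. by rewrite ltn_half_double -mul2n. Qed.

(* Indices start at 0: with i counted from 1, the positions 2i-1 and 2i of the
   i-th conjugate pair are [idx1] and [idx2] of the ordinal of value i-1. *)
Definition idx1 (n : nat) (i : 'I_n) : 'I_(2 * n) := Ordinal (idx1_subproof i).
Definition idx2 (n : nat) (i : 'I_n) : 'I_(2 * n) := Ordinal (idx2_subproof i).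

Definition pair_of (n : nat) (k : 'I_(2 * n)) : 'I_n :=
  Ordinal (half_subproof k).

Definition hamiltonian (R : realType) (n : nat) (P : polyvf R (2 * n)) : Prop :=
  exists H : 'cV[R]_(2 * n) -> R, smooth H /\
    forall (i : 'I_n) (x : 'cV[R]_(2 * n)),
      meval (fun j => x j 0) (P (idx1 i) 0) = - partial (idx2 i) H x /\
      meval (fun j => x j 0) (P (idx2 i) 0) = partial (idx1 i) H x.

Definition hmatrix (R : realType) (n : nat) (A : 'M[R]_(2 * n)) :
    'M[R]_(2 * n) :=
  \matrix_(k, j)
    if odd k then - A (idx1 (pair_of k)) j else A (idx2 (pair_of k)) j.

Lemma hmatrix_idx1 (R : realType) (n : nat) (A : 'M[R]_(2 * n)) i j :
  hmatrix A (idx1 i) j = A (idx2 i) j.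
Proof.
rewrite mxE /= mul2n odd_double; congr (A _ j).
by apply: val_inj; rewrite /= !mul2n doubleK.
Qed.

Lemma hmatrix_idx2 (R : realType) (n : nat) (A : 'M[R]_(2 * n)) i j :
  hmatrix A (idx2 i) j = - A (idx1 i) j.
Proof.
rewrite mxE /= mul2n odd_double /=; congr (- A _ j).
by apply: val_inj; rewrite /= !mul2n uphalf_double.
Qed.

(* Main.v *)
Require Import Defs.
From HB Require Import structures.
From mathcomp Require Import all_boot all_order all_algebra.
From mathcomp Require Import all_classical all_reals all_analysis.
From mathcomp Require mpoly.
From mathcomp Require Import ring lra.
Import -(notations) mpoly.

(** Write [B] for [hmatrix A].  Since [P] evaluates to [A *m x], Hamilton's
    equations for [H] say exactly that the gradient of [H] at [x] is [B *m x]
    ([hamiltonianP]): the rows of [B] are those of [A], swapped and signed within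
    each conjugate pair as the partial derivatives of [H] are.  So the claim is
    that the linear field [x |-> B *m x] is a gradient iff [B] is symmetric.

    If [B] is symmetric, the quadratic form [H x = x^T *m B *m x / 2] is a
    potential.  It is a polynomial, and polynomial functions are smooth
    ([smooth_polyfun]) with partial derivatives given by the formal ones
    ([partial_polyfun]).

    Conversely, a linear gradient determines the increments of [H] along each
    coordinate axis ([increment_of_linear_gradient]).  Going from [0] to
    [e_j + e_k] along the two sides of the parallelogram that starts with [e_j],
    [H] grows by [B j j / 2 + B k k / 2 + B k j]; along the other two sides,
    the cross term is [B j k].  Hence [B j k = B k j].  This replaces the symmetry
    of second derivatives by an elementary integration along segments. *)

Import GRing.Theory Num.Theory.
Import numFieldNormedType.Exports.

Local Open Scope ring_scope.

(** * Polynomial functions are smooth *)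

(** Continuity and the derivative rules are stable under sums and products, so it
    is enough to check them on constants and variables. *)
Lemma mpoly_generators_ind {R : comNzRingType} {m : nat}
    (T : mpoly m R -> Prop) :
  (forall c, T (mpolyC m c)) -> (forall i, T (mpolyX R (mnm1 i))) ->
  (forall p q, T p -> T q -> T (p + q)) ->
  (forall p q, T p -> T q -> T (p * q)) ->
  forall p, T p.
Proof.
move=> TC TX TD TM; elim/mpolyind=> [|c u p _ _ Tp].
  by rewrite -[0](mpolyC0 m R); exact: TC.
apply: (TD) => //; rewrite -mul_mpolyC; apply: (TM) => //.
rewrite mpolyXE_id; elim/big_rec: _ => [|i q _ Tq]; first exact: TC.
apply: (TM) => //; elim: (u i) => [|d IH]; first exact: TC.
by rewrite exprS; exact: TM.
Qed.

Definition polyfun {R : realType} {m : nat} (p : mpoly m R) (x : 'cV[R]_m) : R :=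
  meval (fun j => x j 0) p.

Section PolynomialFunctions.
Context {R : realType} {m : nat}.
Implicit Types (p q : mpoly m R) (x v : 'cV[R]_m).

Lemma polyfunC c : polyfun (mpolyC m c) = cst c :> ('cV[R]_m -> R).
Proof. by apply/funext => x; rewrite /polyfun mevalC. Qed.

Lemma polyfunX i : polyfun (mpolyX R (mnm1 i)) = (fun x => x i 0).
Proof. by apply/funext => x; rewrite /polyfun mevalXU. Qed.

Lemma polyfunD p q : polyfun (p + q) = polyfun p + polyfun q.
Proof. by apply/funext => x; rewrite /polyfun mevalD. Qed.

Lemma polyfunM p q : polyfun (p * q) = polyfun p * polyfun q.
Proof. by apply/funext => x; rewrite /polyfun mevalM. Qed.

Lemma continuous_polyfun p : continuous (polyfun p).
Proof.
elim/(@mpoly_generators_ind R m): p => [c|i|p q cp cq|p q cp cq] x.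
- by rewrite polyfunC; exact: cst_continuous.
- by rewrite polyfunX; exact: coord_continuous.
- by rewrite polyfunD; exact: continuousD (cp x) (cq x).
- by rewrite polyfunM; exact: continuousM (cp x) (cq x).
Qed.

(** The difference quotient of a coordinate is constant off [0]. *)
Lemma is_derive_coord i x v : is_derive x v (fun y => y i 0 : R) (v i 0).
Proof.
have quotient_cvg :
    (h^-1 *: (((fun y : 'cV[R]_m => y i 0 : R) \o shift x) (h *: v) - x i 0)
     @[h --> (0 : R)^'] --> v i 0)%classic.
  apply: (@cvg_near_cst _ _ _ _ _ (dnbhs_filter (0 : R))).
  near=> h; rewrite /= !mxE addrK /GRing.scale /= mulKf //.
  by near: h; exact: nbhs_dnbhs_neq.
by split; [apply: cvgP quotient_cvg | exact: cvg_lim quotient_cvg].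
Unshelve. all: by end_near.
Qed.

Lemma mderiv_var i j :
  mderiv j (mpolyX R (mnm1 i)) = mpolyC m (i == j)%:R.
Proof.
rewrite mderivX mnm1E; case: eqP => [->|_]; last by rewrite scale0r mpolyC0.
by rewrite -{1}[mnm1 j]add0m addmK mpolyX0 scale1r.
Qed.

Lemma is_derive_polyfun p i x :
  is_derive x (delta_mx i 0) (polyfun p) (polyfun (mderiv i p) x).
Proof.
elim/(@mpoly_generators_ind R m): p => [c|j|p q dp dq|p q dp dq].
- by rewrite mderivC -(mpolyC0 m R) !polyfunC; exact: is_derive_cst.
- rewrite mderiv_var polyfunX polyfunC.
  apply: is_derive_eq (is_derive_coord j x _) _.
  by rewrite mxE eqxx andbT.
- by rewrite mderivD !polyfunD; exact: is_deriveD.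
- rewrite mderivM polyfunD !polyfunM.
  apply: is_derive_eq (is_deriveM dp dq) _.
  by rewrite addrC /GRing.scale /= [_ q x * _]mulrC.
Qed.

Lemma partial_polyfun p i : partial i (polyfun p) = polyfun (mderiv i p).
Proof.
by apply/funext => x; exact: @derive_val _ _ _ _ _ _ _ (is_derive_polyfun p i x).
Qed.

(** Partial derivatives of polynomial functions are again polynomial functions,
    so induction on the order of differentiability needs only their continuity. *)
Lemma smooth_polyfun p : smooth (polyfun p).
Proof.
move=> k; elim: k p => [|k IH] p; first exact: continuous_polyfun.
split=> [|i]; first exact: continuous_polyfun.
split=> [x|]; last by rewrite partial_polyfun; exact: IH.
exact: @ex_derive _ _ _ _ _ _ _ (is_derive_polyfun p i x).
Qed.

End PolynomialFunctions.

(** * Linear gradient fields *)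

Section LinearGradient.
Context {R : realType} {m : nat}.
Implicit Types (B : 'M[R]_m) (H : 'cV[R]_m -> R) (x v : 'cV[R]_m).

Definition has_gradient B H := forall i x, partial i H x = (B *m x) i 0.

Definition quadratic_form B : mpoly m R :=
  \sum_i \sum_j mpolyC m (B i j / 2) * (mpolyX R (mnm1 i) * mpolyX R (mnm1 j)).

(** The product rule yields half of [B *m x] and half of [B^T *m x]. *)
Lemma gradient_quadratic_form B :
  B^T = B -> has_gradient B (polyfun (quadratic_form B)).
Proof.
move=> B_sym k x; rewrite partial_polyfun /polyfun /quadratic_form.
have -> : meval (fun j => x j 0) (mderiv k (quadratic_form B)) =
    \sum_i \sum_j B i j / 2 * ((i == k)%:R * x j 0 + x i 0 * (j == k)%:R).
  rewrite /quadratic_form (raddf_sum (mderiv k)) (raddf_sum (meval _)).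
  apply: eq_bigr => i _.
  rewrite (raddf_sum (mderiv k)) (raddf_sum (meval _)); apply: eq_bigr => j _.
  by rewrite /= mderiv_mulC mderivM !mderiv_var mevalM mevalD !mevalM !mevalC
    !mevalXU.
transitivity (\sum_j B k j / 2 * x j 0 + \sum_i B i k / 2 * x i 0).
  under eq_bigr do (under eq_bigr do rewrite mulrDr; rewrite big_split /=).
  rewrite big_split /=; congr (_ + _).
    rewrite (bigD1 k) //= [X in _ + X]big1 => [|i /negPf ->].
      by rewrite addr0; apply: eq_bigr => j _; rewrite eqxx mul1r.
    by apply: big1 => j _; rewrite mul0r mulr0.
  apply: eq_bigr => i _; rewrite (bigD1 k) //= eqxx mulr1.
  by rewrite big1 ?addr0 // => j /negPf ->; rewrite !mulr0.
rewrite -big_split mxE; apply: eq_bigr => i _ /=.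
have -> : B i k = B k i by rewrite -{1}B_sym mxE.
by field.
Qed.

(** Both derivatives are limits of the same difference quotient. *)
Lemma is_derive_along {H x v t} :
  derivable H (t *: v + x) v ->
  is_derive t (1 : R) (fun s => H (s *: v + x)) ('D_v H (t *: v + x)).
Proof.
move=> dH; suff quotientE :
    (fun h : R => h^-1 *: (((fun s => H (s *: v + x)) \o shift t) (h *: (1 : R))
       - H (t *: v + x))) =
    (fun h => h^-1 *: ((H \o shift (t *: v + x)) (h *: v) - H (t *: v + x))).
  by split; rewrite /derivable /derive quotientE.
apply/funext => h /=; congr (_ *: (H _ - _)).
by rewrite [h *: 1]mulr1 scalerDl addrA.
Qed.

(** Along the line [t |-> t *: e_j + x] the derivative of [H] is the affine
    function [b + t * B j j] with [b = (B *m x) j 0].  Subtracting its explicit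
    primitive leaves a function [phi] with zero derivative, hence a constant. *)
Lemma increment_of_linear_gradient {B H} j x :
  smooth H -> has_gradient B H ->
  H (delta_mx j 0 + x) = H x + (B *m x) j 0 + B j j / 2.
Proof.
move=> H_smooth H_grad; set v := delta_mx j 0; set b := (B *m x) j 0.
pose phi (t : R) := H (t *: v + x) - (t * b + t * t * (B j j / 2)).
have phi' (t : R) : is_derive t (1 : R) phi 0.
  have dH : derivable H (t *: v + x) v by case: (H_smooth 1%N) => _ /(_ j)[].
  have := is_derive_along dH; rewrite -/(partial j H _) H_grad => dHt.
  have did := is_derive_id t (1 : R).
  have dlin := is_deriveM did (is_derive_cst b t 1).
  have dquad := is_deriveM (is_deriveM did did) (is_derive_cst (B j j / 2) t 1).
  apply: is_derive_eq (is_deriveB dHt (is_deriveD dlin dquad)) _.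
  have -> : (B *m (t *: v + x)) j 0 = t * B j j + b.
    rewrite mulmxDr -scalemxAr -colE mxE -/b; congr (_ + _).
    by rewrite !mxE.
  by rewrite /GRing.scale /= -[(id * id) t]/(t * t); field.
have := is_derive_0_is_cst 1 0 phi'.
rewrite /phi scale1r scale0r add0r => /eqP; rewrite subr_eq => /eqP ->.
by field.
Qed.

(** Both orders of adding [e_j] and [e_k] to [0] lead to the same point, and the
    increments of [H] along them differ only in the cross terms [B j k], [B k j]. *)
Lemma linear_gradient_sym B H : smooth H -> has_gradient B H -> B^T = B.
Proof.
move=> H_smooth H_grad; apply/matrixP => j k; rewrite mxE.
pose e i : 'cV[R]_m := delta_mx i 0.
have incr i y := increment_of_linear_gradient i y H_smooth H_grad.
have := incr j (e k + 0); rewrite addrCA !incr !mulmxDr mulmx0 !addr0 -!colE !mxE.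
by move=> eqH; apply/eqP; rewrite -subr_eq0; apply/eqP; lra.
Qed.

End LinearGradient.

(** * Hamilton's equations as a gradient condition *)

Lemma idx_cases {n : nat} (Q : 'I_(2 * n) -> Prop) :
  (forall i, Q (idx1 i)) -> (forall i, Q (idx2 i)) -> forall k, Q k.
Proof.
move=> Q1 Q2 k; have := odd_double_half k; case: (boolP (odd k)) => _ kE.
  rewrite (_ : k = idx2 (pair_of k)) //.
  by apply: val_inj; rewrite /= [(2 * k./2)%N]mul2n -[LHS]kE.
rewrite (_ : k = idx1 (pair_of k)) //.
by apply: val_inj; rewrite /= [(2 * k./2)%N]mul2n -[LHS]kE.
Qed.

Lemma polyfun_linear {R : realType} {m : nat} (A : 'M[R]_m) k x :
  polyfun ((map_mx (@mpolyC m R) A *m coords R m) k 0) x = (A *m x) k 0.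
Proof.
rewrite /polyfun !mxE raddf_sum; apply: eq_bigr => j _.
by rewrite !mxE /= mevalM mevalC mevalXU.
Qed.

Lemma hamiltonianP {R : realType} {n : nat} (A : 'M[R]_(2 * n)) :
  hamiltonian (map_mx (@mpolyC (2 * n) R) A *m coords R (2 * n)) <->
  exists H, smooth H /\ has_gradient (hmatrix A) H.
Proof.
have mul1 i x : (hmatrix A *m x) (idx1 i) 0 = (A *m x) (idx2 i) 0.
  by rewrite !mxE; apply: eq_bigr => j _; rewrite hmatrix_idx1.
have mul2 i x : (hmatrix A *m x) (idx2 i) 0 = - (A *m x) (idx1 i) 0.
  by rewrite !mxE -sumrN; apply: eq_bigr => j _; rewrite hmatrix_idx2 mulNr.
split=> -[H [H_smooth H_eqs]]; exists H; split=> //.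
  apply: idx_cases => i x; have [] := H_eqs i x; rewrite -!/(polyfun _ _).
    by move=> _ <-; rewrite polyfun_linear mul1.
  by rewrite polyfun_linear mul2 => -> _; rewrite opprK.
move=> i x; rewrite -!/(polyfun _ _) !polyfun_linear !H_eqs mul1 mul2.
by rewrite opprK.
Qed.

Theorem theorem1p2 (R : realType) (n : nat) (n_gt0 : (0 < n)%N)
    (P : 'cV[mpoly (2 * n) R]_(2 * n)) (A : 'M[R]_(2 * n))
    (P_degree : vf_degree P = 1%N)
    (P_sphere : vf_on_sphere P)
    (P_linear : P = map_mx (@mpolyC (2 * n) R) A *m coords R (2 * n))
    (A_skew : A^T = - A) :
  hamiltonian P <-> (hmatrix A)^T = hmatrix A.
Proof.
rewrite P_linear hamiltonianP; split=> [[H [H_smooth H_grad]]|B_sym].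
  exact: linear_gradient_sym H_smooth H_grad.
exists (polyfun (quadratic_form (hmatrix A))); split.
  exact: smooth_polyfun.
exact: gradient_quadratic_form.
Qed.
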